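(* Let $k>1$ be an integer, let $U$ be a bounded domain in $\mathbb{C}^n$ and $V$ a bounded domain in $\mathbb{C}^m$, and let $F\colon U\to V$ be a holomorphic mapping which is injective on free homotopy in the sense that the $F$-image of every nontrivial free homotopy class of maps $S^k\to U$ is nontrivial in $V$. Then $$\ell_k(V)\le\ell_k(U).$$
   Context: For a metric space $(X,d)$, $A\subset X$, and $k\ge 0$, the $k$-dimensional Hausdorff measure is $$\mu^k_{X,d}(A)=\sup_{\epsilon>0}\inf\Big\{\sum_{i=1}^\infty(\delta(A_i))^k\colon A=\bigcup_{i=1}^\infty A_i,\ \delta(A_i)<\epsilon\Big\},$$ where $\delta(A_i)=\sup_{p,q\in A_i}d(p,q)$. For a bounded domain $U\subset\mathbb{C}^n$, $\mu^k_{\mathrm{Kob},U}$ denotes the $k$-dimensional Hausdorff measure with respect to the Kobayashi distance of $U$. $S^k$ is the unit sphere in $\mathbb{R}^{k+1}$. Two continuous maps $f_0,f_1\colon S^k\to U$ are free-homotopic if there is a continuous $H\colon S^k\times[0,1]\to U$ with $H(\cdot,0)=f_0$, $H(\cdot,1)=f_1$; a free homotopy class is nontrivial if it does not contain a constant map. A continuous map $f\colon S^k\to U$ is Hausdorff-Kobayashi $k$-rectifiable if $\mu^k_{\mathrm{Kob},U}(f(S^k))<\infty$. The invariant $\ell_k(U)$ is the infimum of $\mu^k_{\mathrm{Kob},U}(f(S^k))$ over all Hausdorff-Kobayashi $k$-rectifiable representatives $f$ of nontrivial free homotopy classes of maps $S^k\to U$ (with $\inf\varnothing=+\infty$). *)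

(* Defs.v *)
From HB Require Import structures.
From mathcomp Require Import all_boot all_order all_algebra.
From mathcomp Require Import all_classical all_reals all_analysis.
From mathcomp Require Import complex.
Set Implicit Arguments.
Unset Strict Implicit.
Unset Printing Implicit Defensive.
Import Order.TTheory GRing.Theory Num.Theory.
Import numFieldNormedType.Exports.
Local Open Scope classical_set_scope.
Local Open Scope ring_scope.

(* [R[i]^o] is the field C seen as a normed space over itself; [R[i]] alone
   carries no topology. *)
Notation Cvec R n := 'rV[R[i]^o]_n.

Section Hausdorff.
Context {R : realType} {X : Type}.
Implicit Types (d : X -> X -> \bar R) (A : set X).
Local Open Scope ereal_scope.

(* The join with 0 only matters for the empty set, whose diameter is 0. *)
Definition diameter d A : \bar R :=
  maxe 0 (ereal_sup [set d p q | p in A & q in A]).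

Definition hausdorff_covers d (e : R) A : set (nat -> set X) :=
  [set C | A = \bigcup_i C i /\ forall i, diameter d (C i) < e%:E].

(* [s] is the dimension; since [0 `^ 0 = 1], the value [s = 0] would count the
   empty pieces of a covering. *)
Definition hausdorff_measure d (s : R) A : \bar R :=
  ereal_sup [set ereal_inf [set \sum_(i <oo) (diameter d (C i)) `^ s |
                            C in hausdorff_covers d e A] |
             e in [set e : R | (0 < e)%R]].

End Hausdorff.

Section Kobayashi.
Context {R : realType}.

Definition bounded_domain n (U : set (Cvec R n)) : Prop :=
  [/\ open U, connected U, U !=set0 & bounded_set U].

(* Differentiability is over the scalar field C, i.e. complex
   differentiability; the values of [f] outside [D] are irrelevant when [D] is
   open. *)
Definition holomorphic_map (V W : normedModType R[i])
    (D : set V) (E : set W) (f : V -> W) : Prop :=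
  (forall z, D z -> differentiable f z) /\ (forall z, D z -> E (f z)).

Definition unit_disc : set R[i]^o := [set z | `|z| < 1].

(* Distance of the Poincare metric |dz| / (1 - |z|^2), i.e.
   artanh |(a - b) / (1 - conj(a) b)|. *)
Definition poincare_dist (a b : R[i]) : R :=
  let t := Normc.normc ((a - b) / (1 - conjc a * b)) in
  ln ((1 + t) / (1 - t)) / 2.

(* A chain of N holomorphic discs in U from p = x 0 to q = x N. *)
Definition disc_chain n (U : set (Cvec R n)) (p q : Cvec R n) (N : nat)
    (x : nat -> Cvec R n) (f : nat -> R[i]^o -> Cvec R n)
    (a b : nat -> R[i]^o) : Prop :=
  [/\ x 0%N = p, x N = q &
      forall j, (j < N)%N ->
        [/\ unit_disc (a j), unit_disc (b j),
            holomorphic_map unit_disc U (f j),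
            f j (a j) = x j & f j (b j) = x j.+1]].

(* The infimum is taken in the extended reals; it is finite for p and q in the
   same connected component of U. *)
Definition kobayashi_dist n (U : set (Cvec R n)) (p q : Cvec R n) : \bar R :=
  ereal_inf [set l | exists N x f a b, disc_chain U p q N x f a b /\
    l = (\sum_(j < N) poincare_dist (a j) (b j))%:E].

Definition kobayashi_measure n (U : set (Cvec R n)) (s : R) :
    set (Cvec R n) -> \bar R :=
  hausdorff_measure (kobayashi_dist U) s.

End Kobayashi.

Section FreeHomotopy.
Context {R : realType}.

(* The unit sphere S^k of R^(k+1), for the Euclidean norm (the library norm on
   'rV[R]_k.+1 is the sup norm). *)
Definition sphere (k : nat) : set 'rV[R]_k.+1 :=
  [set x | \sum_(i < k.+1) x ord0 i ^+ 2 = 1].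
Arguments sphere k : clear implicits.

(* Maps S^k -> U are represented by functions on the ambient space of which
   only the restriction to the sphere matters. *)
Definition sphere_map k n (U : set (Cvec R n)) : set ('rV[R]_k.+1 -> Cvec R n) :=
  [set f | {within sphere k, continuous f} /\
           (forall x, sphere k x -> U (f x))].

Definition free_homotopic k n (U : set (Cvec R n))
    (f0 f1 : 'rV[R]_k.+1 -> Cvec R n) : Prop :=
  exists H : 'rV[R]_k.+1 * R -> Cvec R n,
    [/\ {within sphere k `*` `[0, 1]%classic, continuous H},
        (forall xt, (sphere k `*` `[0, 1]%classic) xt -> U (H xt)),
        (forall x, sphere k x -> H (x, 0) = f0 x) &
        (forall x, sphere k x -> H (x, 1) = f1 x)].

Definition homotopy_class k n (U : set (Cvec R n))
    (f : 'rV[R]_k.+1 -> Cvec R n) : set ('rV[R]_k.+1 -> Cvec R n) :=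
  [set g | sphere_map U g /\ free_homotopic U f g].

Definition is_homotopy_class k n (U : set (Cvec R n))
    (c : set ('rV[R]_k.+1 -> Cvec R n)) : Prop :=
  exists2 f, sphere_map U f & c = homotopy_class U f.

(* A homotopy class is insensitive to the values off the sphere, so it contains
   a map constant on the sphere iff it contains some [cst p]. *)
Definition nontrivial_class k n (c : set ('rV[R]_k.+1 -> Cvec R n)) : Prop :=
  forall p : Cvec R n, ~ c (cst p).

(* The free homotopy class in V of the maps F \o f, for f in the class c. *)
Definition image_class k n m (V : set (Cvec R m)) (F : Cvec R n -> Cvec R m)
    (c : set ('rV[R]_k.+1 -> Cvec R n)) : set ('rV[R]_k.+1 -> Cvec R m) :=
  \bigcup_(f in c) homotopy_class V (F \o f).

Definition injective_on_free_homotopy k n m (U : set (Cvec R n))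
    (V : set (Cvec R m)) (F : Cvec R n -> Cvec R m) : Prop :=
  forall c : set ('rV[R]_k.+1 -> Cvec R n),
    is_homotopy_class U c -> nontrivial_class c ->
    nontrivial_class (image_class V F c).

Definition rectifiable k n (U : set (Cvec R n))
    (f : 'rV[R]_k.+1 -> Cvec R n) : Prop :=
  sphere_map U f /\ (kobayashi_measure U k%:R (f @` sphere k) < +oo)%E.

Definition ell (k : nat) n (U : set (Cvec R n)) : \bar R :=
  ereal_inf [set kobayashi_measure U k%:R (f @` sphere k) | f in
    [set f : 'rV[R]_k.+1 -> Cvec R n | rectifiable U f /\
      exists c, [/\ is_homotopy_class U c, nontrivial_class c & c f]]].

End FreeHomotopy.

Arguments sphere {R} k.
Arguments injective_on_free_homotopy {R} k {n m} U V F.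
Arguments ell {R} k {n} U.

(* Main.v *)
Require Import Defs.
From HB Require Import structures.
From mathcomp Require Import all_boot all_order all_algebra.
From mathcomp Require Import all_classical all_reals all_analysis.
From mathcomp Require Import complex.
Import Order.TTheory GRing.Theory Num.Theory.
Import numFieldNormedType.Exports.
Local Open Scope classical_set_scope.
Local Open Scope ring_scope.

(** The Kobayashi pseudodistance is contracted by holomorphic maps: composing
    with [F] sends chains of discs in [U] to chains of discs in [V] with the
    same Poincare lengths ([kobayashi_dist_contract]). A map that does not
    increase distances does not increase Hausdorff measures either, because the
    images of the pieces of a covering cover the image and are no larger
    ([hausdorff_measure_image]). So if a sphere [f] competes in the infimum
    that defines [ell k U], then [F \o f] has at most the same measure, and it
    competes in [ell k V], since its free homotopy class is nontrivial by the
    hypothesis on [F]. *)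

Lemma diameter_ge0 (R : realType) (X : Type) (d : X -> X -> \bar R) (A : set X) :
  (0 <= diameter d A)%E.
Proof. by rewrite /diameter le_max lexx. Qed.

Section HausdorffContraction.
Context {R : realType} {X Y : Type}.
Variables (dX : X -> X -> \bar R) (dY : Y -> Y -> \bar R) (F : X -> Y).
Hypothesis F_contract : forall p q, (dY (F p) (F q) <= dX p q)%E.
Local Open Scope ereal_scope.

Lemma diameter_image (A : set X) : diameter dY (F @` A) <= diameter dX A.
Proof.
rewrite [leLHS]/diameter ge_max diameter_ge0 /=.
apply: ge_ereal_sup => _ [_ [p Ap <-]] [_ [q Aq <-]] <-.
apply: (le_trans (F_contract p q)).
by rewrite /diameter le_max ereal_sup_ubound ?orbT //; exists p => //; exists q.
Qed.

Lemma hausdorff_covers_image e (A : set X) (C : nat -> set X) :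
  hausdorff_covers dX e A C ->
  hausdorff_covers dY e (F @` A) (fun i => F @` C i).
Proof.
move=> [-> Ce]; split; first exact: image_bigcup.
by move=> i; apply: le_lt_trans (Ce i); exact: diameter_image.
Qed.

(** Each covering of [A] gives, piece by piece, a covering of the image with
    the same mesh bound and no larger diameters; a nonnegative exponent makes the
    sum monotone in the diameters. *)
Lemma hausdorff_measure_image (s : R) (A : set X) : (0 <= s)%R ->
  hausdorff_measure dY s (F @` A) <= hausdorff_measure dX s A.
Proof.
move=> s0; apply: ge_ereal_sup => _ [e e0 <-].
apply: (@le_trans _ _ (ereal_inf [set \sum_(i <oo) (diameter dX (C i)) `^ s |
                                  C in hausdorff_covers dX e A])); last first.
  by apply: ereal_sup_ubound; exists e.
apply: le_ereal_inf_tmp => _ [C CA <-].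
apply: (@le_trans _ _ (\sum_(i <oo) (diameter dY (F @` C i)) `^ s)).
  by apply: ereal_inf_lbound; exists (fun i => F @` C i) => //;
     exact: hausdorff_covers_image.
apply: lee_nneseries => [i _ _|i _]; first exact: poweR_ge0.
apply: gt0_ler_poweR => //; last exact: diameter_image.
all: by rewrite in_itv /= leey andbT diameter_ge0.
Qed.

End HausdorffContraction.

Lemma holomorphic_map_comp (R : realType) (V1 V2 V3 : normedModType R[i])
    (D : set V1) (E : set V2) (G : set V3) (f : V1 -> V2) (g : V2 -> V3) :
  holomorphic_map D E f -> holomorphic_map E G g ->
  holomorphic_map D G (g \o f).
Proof.
move=> [df Df] [dg Eg]; split=> z Dz; last exact/Eg/Df.
by apply: differentiable_comp; [exact: df | exact/dg/Df].
Qed.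

Lemma kobayashi_dist_contract (R : realType) (n m : nat)
    (U : set (Cvec R n)) (V : set (Cvec R m)) (F : Cvec R n -> Cvec R m) :
  holomorphic_map U V F ->
  forall p q, (kobayashi_dist V (F p) (F q) <= kobayashi_dist U p q)%E.
Proof.
move=> hF p q; apply: ereal_inf_le_tmp => _ [N [x [f [a [b [[x0 xN fx] ->]]]]]].
exists N, (F \o x), (fun j => F \o f j), a, b; split=> //.
split=> [||j jN] /=; [by rewrite x0 | by rewrite xN |].
have [aj bj fj fa fb] := fx j jN; split=> //; last 2 first.
- by rewrite fa.
- by rewrite fb.
exact: holomorphic_map_comp hF.
Qed.

Lemma sphere_map_comp (R : realType) (k n m : nat)
    (U : set (Cvec R n)) (V : set (Cvec R m)) (F : Cvec R n -> Cvec R m)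
    (f : 'rV[R]_k.+1 -> Cvec R n) :
  holomorphic_map U V F -> sphere_map U f -> sphere_map V (F \o f).
Proof.
move=> [dF UV] [/subspace_continuousP cf fU]; split; last first.
  by move=> x /fU /UV.
apply/subspace_continuousP => x Sx.
apply: cvg_comp (cf x Sx) _.
exact: (differentiable_continuous (dF _ (fU _ Sx))).
Qed.

(** Witnessed by the homotopy that does not depend on time. *)
Lemma free_homotopic_refl (R : realType) (k n : nat) (U : set (Cvec R n))
    (f : 'rV[R]_k.+1 -> Cvec R n) :
  sphere_map U f -> free_homotopic U f f.
Proof.
move=> [/subspace_continuousP cf fU]; exists (f \o fst); split=> //.
- apply/subspace_continuousP => -[x t] [/= Sx _].
  apply: cvg_comp (cf x Sx) => P /= xP.
  have := @cvg_fst _ _ (nbhs x) (nbhs t) (nbhs_filter t) _ xP.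
  apply: (@filterS _ (nbhs (x, t)) (nbhs_filter (x, t))) => z zP [/= Sz _].
  exact: zP.
- by move=> [x t] [/= Sx _]; exact: fU.
Qed.

Theorem lemma6p2 (R : realType) (k n m : nat) (hk : (1 < k)%N)
    (U : set (Cvec R n)) (V : set (Cvec R m))
    (hU : bounded_domain U) (hV : bounded_domain V)
    (F : Cvec R n -> Cvec R m) (hF : holomorphic_map U V F)
    (hFinj : injective_on_free_homotopy k U V F) :
  (ell k V <= ell k U)%E.
Proof.
apply: le_ereal_inf_tmp => _ [f [[Sf f_fin] [c [c_class c_nontriv cf]]] <-].
have le_measure : (kobayashi_measure V k%:R ((F \o f) @` sphere k) <=
                   kobayashi_measure U k%:R (f @` sphere k))%E.
  rewrite -image_comp; apply: hausdorff_measure_image (ler0n _ _).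
  exact: kobayashi_dist_contract.
have SFf := sphere_map_comp R k n m U V F f hF Sf.
apply: (le_trans _ le_measure); apply: ereal_inf_lbound; exists (F \o f) => //.
split; first by split=> //; exact: (le_lt_trans le_measure f_fin).
exists (homotopy_class V (F \o f)); split.
- by exists (F \o f).
(* [f] lies in [c], so the class of [F \o f] is part of the image of [c] *)
- by move=> p Ffp; apply: (hFinj c c_class c_nontriv p); exists f.
- by split=> //; exact: free_homotopic_refl.
Qed.
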